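(* Let $C_i\subseteq\mathbb F_q^{n_i}$ ($i\in[t]$) be classical codes and let $c\in C_1\boxplus\cdots\boxplus C_t$. For any two decompositions $c=c_1+\cdots+c_t=c_1'+\cdots+c_t'$ with $c_i,c_i'\in C^{(i)}$ for all $i\in[t]$, there exist $c_{i,j}\in C^{(i,j)}$ for $1\le i<j\le t$ such that for all $i\in[t]$, $$c_i-c_i'=\sum_{j=1}^{i-1}c_{j,i}-\sum_{j=i+1}^{t}c_{i,j}.$$
   Context: Identify $\mathbb F_q^{n_1}\otimes\cdots\otimes\mathbb F_q^{n_t}$ with $t$-dimensional arrays; a direction-$i$ column is the vector in $\mathbb F_q^{n_i}$ obtained by fixing all coordinates except the $i$-th. $C^{(i)}=\mathbb F_q^{n_1}\otimes\cdots\otimes C_i\otimes\cdots\otimes\mathbb F_q^{n_t}$ is the space of arrays all of whose direction-$i$ columns lie in $C_i$; $C^{(i,j)}=C^{(i)}\cap C^{(j)}$; $C_1\boxplus\cdots\boxplus C_t=C^{(1)}+\cdots+C^{(t)}$. *)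

(* Defs.v *)
From HB Require Import structures.
From mathcomp Require Import all_boot all_order all_algebra all_field.
Set Implicit Arguments. Unset Strict Implicit. Unset Printing Implicit Defensive.
Import GRing.Theory.
Local Open Scope ring_scope.

Definition pos (t : nat) (n : 'I_t -> nat) : finType :=
  {dffun forall i : 'I_t, 'I_(n i)}.

(* Arrays = elements of F^{n_1} (x) ... (x) F^{n_t}. *)
Definition array (F : fieldType) (t : nat) (n : 'I_t -> nat) :=
  {ffun pos n -> F}.

Definition column (F : fieldType) (t : nat) (n : 'I_t -> nat)
    (a : array F n) (i : 'I_t) (x : pos n) : 'rV[F]_(n i) :=
  \row_(k < n i) a (finfun (dfwith (fun j => x j) k)).

Definition inCi (F : fieldType) (t : nat) (n : 'I_t -> nat)
    (C : forall i : 'I_t, {vspace 'rV[F]_(n i)}) (i : 'I_t) (a : array F n) :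
    Prop :=
  forall x : pos n, column a i x \in C i.

Definition inCij (F : fieldType) (t : nat) (n : 'I_t -> nat)
    (C : forall i : 'I_t, {vspace 'rV[F]_(n i)}) (i j : 'I_t) (a : array F n) :
    Prop :=
  inCi C i a /\ inCi C j a.

(* Main.v *)
Require Import Defs.
From HB Require Import structures.
From mathcomp Require Import all_boot all_order all_algebra all_field.
Import GRing.Theory.
Local Open Scope ring_scope.

(* Applying the projection of F^(n_i) onto C_i to every direction-i column
   gives an additive projection P_i of arrays with fixed space C^(i); the P_i
   are idempotent and pairwise commuting.  The differences d_i = c_i - c_i'
   are fixed by P_i and sum to 0.  With Q_i = prod_(i < k < t) (1 - P_k), put
   c_(i,j) = - P_j Q_j d_i for i < j: it is fixed by P_j, and by P_i since P_i
   commutes with P_j Q_j.  As P_j Q_j = Q_j - Q_(j-1), the sum of the c_(i,j)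
   over j > i telescopes to Q_i d_i - d_i, while Q_i kills every d_j with
   j > i, so the sum of the c_(j,i) over j < i is Q_i d_i. *)

Section CommutingProjections.
Set Implicit Arguments. Unset Strict Implicit.
Variables (V : zmodType) (t : nat) (e : nat -> {additive V -> V}).
Hypothesis e_idem : forall k x, e k (e k x) = e k x.
Hypothesis e_comm : forall k l x, e k (e l x) = e l (e k x).

Definition coprojs (s : seq nat) (x : V) : V :=
  foldr (fun k y => y - e k y) x s.

Lemma coprojs_is_zmod_morphism s : zmod_morphism (coprojs s).
Proof.
move=> x y; elim: s => //= k s ->.
by rewrite raddfB !opprD !opprK addrACA.
Qed.

HB.instance Definition _ s :=
  GRing.isZmodMorphism.Build V V (coprojs s) (coprojs_is_zmod_morphism s).

Lemma e_coprojs k s x : e k (coprojs s x) = coprojs s (e k x).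
Proof. by elim: s => //= l s <-; rewrite raddfB e_comm. Qed.

Lemma coprojs_fixed s k x : k \in s -> e k x = x -> coprojs s x = 0.
Proof.
move=> + ex; elim: s => //= l s IHs.
rewrite in_cons => /orP[/eqP <-|/IHs ->]; last by rewrite raddf0 subrr.
by rewrite e_coprojs ex subrr.
Qed.

Definition coproj_gt (m : nat) : V -> V := coprojs (iota m.+1 (t - m.+1)).

HB.instance Definition _ m :=
  GRing.isZmodMorphism.Build V V (coproj_gt m) (coprojs_is_zmod_morphism _).

Lemma coproj_gt_fixed m k x :
  (m < k < t)%N -> e k x = x -> coproj_gt m x = 0.
Proof.
move=> /andP[lt_mk lt_kt]; apply: coprojs_fixed.
by rewrite mem_iota lt_mk subnKC // (ltn_trans lt_mk lt_kt).
Qed.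

Lemma e_coproj_gtS m x :
  (m.+1 < t)%N -> e m.+1 (coproj_gt m.+1 x) = coproj_gt m.+1 x - coproj_gt m x.
Proof.
move=> lt_mt; rewrite /coproj_gt -[(t - m.+1)%N](subnSK lt_mt) /=.
by rewrite opprB addrC subrK.
Qed.

Lemma coproj_gt_last x : coproj_gt t.-1 x = x.
Proof. by rewrite /coproj_gt; case: t => //= u; rewrite subnn. Qed.

Lemma sum_e_coproj_gt m x : (m < t)%N ->
  \sum_(m.+1 <= j < t) e j (coproj_gt j x) = x - coproj_gt m x.
Proof.
move=> lt_mt; rewrite big_add1 (@telescope_sumr_eq _ m t.-1 (coproj_gt^~ x)).
- by rewrite coproj_gt_last.
- by rewrite -ltnS prednK // (leq_ltn_trans _ lt_mt).
by move=> j /andP[_ lt_jt]; apply: e_coproj_gtS; rewrite -ltn_predRL.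
Qed.

Variable d : nat -> V.
Hypothesis d_fixed : forall k, (k < t)%N -> e k (d k) = d k.
Hypothesis d_sum0 : \sum_(k < t) d k = 0.

Definition overlap (i j : nat) : V := - e j (coproj_gt j (d i)).

Lemma overlap_fixed_r i j : e j (overlap i j) = overlap i j.
Proof. by rewrite /overlap raddfN e_idem. Qed.

Lemma overlap_fixed_l i j : (i < t)%N -> e i (overlap i j) = overlap i j.
Proof. by move=> lt_it; rewrite /overlap !raddfN e_comm e_coprojs d_fixed. Qed.

Lemma sum_overlap_lt i : (i < t)%N ->
  \sum_(0 <= j < i) overlap j i = coproj_gt i (d i).
Proof.
move=> lt_it.
have sum_d_lt : \sum_(0 <= j < i) d j = - d i - \sum_(i.+1 <= j < t) d j.
  move/eqP: d_sum0; rewrite -(big_mkord xpredT).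
  rewrite (big_cat_nat (leq0n i) (ltnW lt_it)) /= (big_ltn lt_it).
  by rewrite addr_eq0 opprD => /eqP.
have coproj_sum_d_gt : coproj_gt i (\sum_(i.+1 <= j < t) d j) = 0.
  rewrite raddf_sum big1_seq // => j /andP[_]; rewrite mem_index_iota.
  move=> /andP[lt_ij lt_jt]; apply: (coproj_gt_fixed (k := j)).
    by rewrite lt_ij.
  exact: d_fixed.
have -> : \sum_(0 <= j < i) overlap j i = - e i (coproj_gt i (\sum_(0 <= j < i) d j)).
  by rewrite /overlap sumrN !raddf_sum.
rewrite sum_d_lt raddfB /= coproj_sum_d_gt subr0.
by rewrite !raddfN opprK e_coprojs d_fixed.
Qed.

Lemma sum_overlap_gt i : (i < t)%N ->
  \sum_(i.+1 <= j < t) overlap i j = coproj_gt i (d i) - d i.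
Proof. by move=> lt_it; rewrite sumrN sum_e_coproj_gt // opprB. Qed.

Lemma overlap_decomposition i : (i < t)%N ->
  d i = \sum_(j < t | (j < i)%N) overlap j i - \sum_(j < t | (i < j)%N) overlap i j.
Proof.
move=> lt_it; have := sum_overlap_gt lt_it; have := sum_overlap_lt lt_it.
rewrite big_mkord (big_ord_widen t (overlap^~ i) (ltnW lt_it)) big_geq_mkord /=.
move=> -> ->.
by rewrite opprB addrC subrK.
Qed.

End CommutingProjections.

Section DirectionalProjection.
Set Implicit Arguments. Unset Strict Implicit.
Variables (F : fieldType) (t : nat) (n : 'I_t -> nat).
Variable C : forall i : 'I_t, {vspace 'rV[F]_(n i)}.

Definition set_coord (x : pos n) (i : 'I_t) (k : 'I_(n i)) : pos n :=
  finfun (dfwith (fun j => x j) k).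
Arguments set_coord x i k : clear implicits.

Lemma set_coord_eq x i k : set_coord x i k i = k.
Proof. by rewrite ffunE dfwith_in. Qed.

Lemma set_coord_neq x i k j : i != j -> set_coord x i k j = x j.
Proof. by move=> neq_ij; rewrite ffunE dfwith_out. Qed.

Lemma set_coord_id x i : set_coord x i (x i) = x.
Proof. by apply/ffunP => j; rewrite ffunE; case: dfwithP. Qed.

Lemma set_coord_set_coord x i k l :
  set_coord (set_coord x i k) i l = set_coord x i l.
Proof.
apply/ffunP => j; rewrite !ffunE.
have [<- | neq_ij] := eqVneq i j; first by rewrite !dfwith_in.
by rewrite !dfwith_out // ffunE dfwith_out.
Qed.

Lemma set_coordC x i j k l : i != j ->
  set_coord (set_coord x i k) j l = set_coord (set_coord x j l) i k.
Proof.
move=> neq_ij; apply/ffunP => m; rewrite !ffunE.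
have [<- | neq_jm] := eqVneq j m.
  by rewrite dfwith_in dfwith_out // ffunE dfwith_in.
rewrite dfwith_out // ffunE.
have [<- | neq_im] := eqVneq i m; first by rewrite !dfwith_in.
by rewrite !dfwith_out // ffunE dfwith_out.
Qed.

(* Entrywise form of projv (C i) on direction-i columns: for i != j the
   projections P_i and P_j then commute by exchanging two sums. *)
Definition dir_proj (i : 'I_t) (a : array F n) : array F n :=
  [ffun x => \sum_(k < n i) a (set_coord x i k) * lin1_mx (projv (C i)) k (x i)].

Lemma column_dir_proj i a x :
  column (dir_proj i a) i x = projv (C i) (column a i x).
Proof.
apply/rowP => k; rewrite -mul_rV_lin1 !mxE ffunE set_coord_eq.
by apply: eq_bigr => l _; rewrite !mxE -/(set_coord _ i l) set_coord_set_coord.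
Qed.

Lemma dir_projE i a x : dir_proj i a x = projv (C i) (column a i x) 0 (x i).
Proof. by rewrite -column_dir_proj mxE -/(set_coord x i _) set_coord_id. Qed.

Lemma inCi_dir_proj i a : inCi C i (dir_proj i a).
Proof. by move=> x; rewrite column_dir_proj memv_proj. Qed.

Lemma dir_proj_id i a : inCi C i a -> dir_proj i a = a.
Proof.
move=> a_in; apply/ffunP => x; rewrite dir_projE projv_id ?a_in //.
by rewrite mxE -/(set_coord x i _) set_coord_id.
Qed.

Lemma dir_proj_is_zmod_morphism i : zmod_morphism (dir_proj i).
Proof.
move=> a b; apply/ffunP => x; rewrite !ffunE -sumrB.
by apply: eq_bigr => k _; rewrite !ffunE mulrBl.
Qed.

HB.instance Definition _ i :=
  GRing.isZmodMorphism.Build _ _ (dir_proj i) (dir_proj_is_zmod_morphism i).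

Lemma dir_projC i j a : dir_proj i (dir_proj j a) = dir_proj j (dir_proj i a).
Proof.
have [-> // | neq_ij] := eqVneq i j.
apply/ffunP => x; rewrite !ffunE.
under eq_bigr => k _ do rewrite ffunE mulr_suml.
under [RHS]eq_bigr => k _ do rewrite ffunE mulr_suml.
rewrite exchange_big /=; apply: eq_bigr => l _; apply: eq_bigr => k _.
by rewrite set_coord_neq // set_coord_neq 1?eq_sym // set_coordC // mulrAC.
Qed.

Definition dir_proj_nat (k : nat) : {additive array F n -> array F n} :=
  if insub k is Some i then dir_proj i else idfun.

Lemma dir_proj_natE (i : 'I_t) : dir_proj_nat i =1 dir_proj i.
Proof. by move=> a; rewrite /dir_proj_nat valK. Qed.

Lemma dir_proj_nat_idem k a :
  dir_proj_nat k (dir_proj_nat k a) = dir_proj_nat k a.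
Proof.
rewrite /dir_proj_nat; case: insub => //= i.
exact/dir_proj_id/inCi_dir_proj.
Qed.

Lemma dir_proj_natC k l a :
  dir_proj_nat k (dir_proj_nat l a) = dir_proj_nat l (dir_proj_nat k a).
Proof.
by rewrite /dir_proj_nat; case: insub => [i|]; case: insub => [j|] //=; apply: dir_projC.
Qed.

End DirectionalProjection.

Theorem lemma3p1 (F : finFieldType) (t : nat) (n : 'I_t -> nat)
    (C : forall i : 'I_t, {vspace 'rV[F]_(n i)})
    (c : array F n) (c1 c2 : 'I_t -> array F n) :
  (forall i, inCi C i (c1 i)) ->
  (forall i, inCi C i (c2 i)) ->
  c = \sum_(i < t) c1 i ->
  c = \sum_(i < t) c2 i ->
  exists cc : 'I_t -> 'I_t -> array F n,
    (forall i j : 'I_t, (i < j)%N -> inCij C i j (cc i j)) /\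
    (forall i : 'I_t,
       c1 i - c2 i = \sum_(j < t | (j < i)%N) cc j i
                     - \sum_(j < t | (i < j)%N) cc i j).
Proof.
move=> c1_in c2_in c_c1 c_c2.
pose e := dir_proj_nat C.
pose d k := if insub k is Some i then c1 i - c2 i else 0.
have dE (i : 'I_t) : d i = c1 i - c2 i by rewrite /d valK.
have d_fixed k : (k < t)%N -> e k (d k) = d k.
  move=> lt_kt; rewrite -[k]/(val (Ordinal lt_kt)) dE /e dir_proj_natE.
  by rewrite raddfB /= !dir_proj_id.
have d_sum0 : \sum_(k < t) d k = 0.
  by under eq_bigr do rewrite dE; rewrite sumrB -c_c1 -c_c2 subrr.
exists (fun i j : 'I_t => overlap t e d i j); split=> [i j _ | i].
  split; [rewrite -(overlap_fixed_l (dir_proj_natC C) d_fixed j (ltn_ord i))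
         | rewrite -(overlap_fixed_r _ (dir_proj_nat_idem C))];
    by rewrite dir_proj_natE; apply: inCi_dir_proj.
by rewrite -dE (overlap_decomposition (dir_proj_natC C) d_fixed d_sum0 (ltn_ord i)).
Qed.
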